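(* Let $\mathcal{C}$ be a regular category. The following conditions are equivalent: (i) $\mathcal{C}$ is a Goursat category; (ii) for any split epimorphisms with given splittings $f\colon X\to Y$ (splitting $i\colon Y\to X$), $l\colon Z\to Y$ (splitting $k\colon Y\to Z$), $g\colon U\to W$ (splitting $j\colon W\to U$) and $h\colon V\to W$ (splitting $m\colon W\to V$), and any regular epimorphisms $\alpha\colon X\to U$, $\beta\colon Y\to W$, $\gamma\colon Z\to V$ such that $$g\alpha=\beta f,\quad \alpha i=j\beta,\quad h\gamma=\beta l,\quad \gamma k=m\beta,$$ the comparison morphism $\lambda\colon X\times_Y Z\to U\times_W V$ between the pullback of $f$ and $l$ and the pullback of $g$ and $h$, induced by $\alpha$ and $\gamma$, is also a regular epimorphism; (iii) for any commutative cube consisting of - a left face which is a pullback of split epimorphisms: split epimorphisms $f\colon X\to Y$ (with splitting $i$) and $l\colon Z\to Y$ (with splitting $k$), together with their pullback $X\times_Y Z$, with projections $\pi_X\colon X\times_Y Z\to X$ (split by $\langle 1_X,kf\rangle$) and $\pi_Z\colon X\times_Y Z\to Z$ (split by $\langle il,1_Z\rangle$); - a right face which is a commutative diagram of split epimorphisms: $g\colon U\to W$ (with splitting $j$), $h\colon V\to W$ (with splitting $m$), $a\colon A\to U$ (with splitting $s$) and $b\colon A\to V$ (with splitting $t$), satisfying $ga=hb$ and $sj=tm$; - horizontal regular epimorphisms $\alpha\colon X\to U$, $\beta\colon Y\to W$, $\gamma\colon Z\to V$, $\delta\colon X\times_Y Z\to A$ commuting with the split epimorphisms and with their splittings, i.e.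 $$g\alpha=\beta f,\quad \alpha i=j\beta,\quad h\gamma=\beta l,\quad \gamma k=m\beta,$$ $$a\delta=\alpha\pi_X,\quad \delta\langle 1_X,kf\rangle=s\alpha,\quad b\delta=\gamma\pi_Z,\quad \delta\langle il,1_Z\rangle=t\gamma,$$ the right face is a pullback, i.e. the square $ga=hb$ exhibits $A$ as the pullback of $g$ and $h$.
   Context: A regular category $\mathcal{C}$ is called a Goursat category when the composition of (effective) equivalence relations on a same object is $3$-permutable: $RSR=SRS$ for any two (effective) equivalence relations $R$ and $S$ on the same object of $\mathcal{C}$, where juxtaposition denotes the composition of relations in the regular category $\mathcal{C}$, and an equivalence relation is effective when it is the kernel pair of some morphism. *)

(* Defs.v *)
Set Implicit Arguments.
Unset Strict Implicit.
Unset Printing Implicit Defensive.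

Record category : Type := Category {
  ob :> Type;
  hom : ob -> ob -> Type;
  idm : forall X : ob, hom X X;
  comp : forall X Y Z : ob, hom Y Z -> hom X Y -> hom X Z;
  comp_idl : forall (X Y : ob) (f : hom X Y), comp (idm Y) f = f;
  comp_idr : forall (X Y : ob) (f : hom X Y), comp f (idm X) = f;
  comp_assoc : forall (X Y Z W : ob) (h : hom Z W) (g : hom Y Z) (f : hom X Y),
    comp h (comp g f) = comp (comp h g) f
}.

Arguments idm {c} X.

Declare Scope cat_scope.
Open Scope cat_scope.
Notation "X ~> Y" := (@hom _ X Y) (at level 90, right associativity) : cat_scope.
Notation "g 'o' f" := (@comp _ _ _ _ g f) (at level 40, left associativity)
  : cat_scope.

Section Notions.

Variable C : category.

Definition is_terminal (T : C) : Prop :=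
  forall X : C, exists! t : X ~> T, True.

Definition is_pullback (X Y Z P : C) (f : X ~> Z) (g : Y ~> Z)
    (p : P ~> X) (q : P ~> Y) : Prop :=
  f o p = g o q /\
  forall (T : C) (a : T ~> X) (b : T ~> Y), f o a = g o b ->
    exists! t : T ~> P, p o t = a /\ q o t = b.

Definition is_coequalizer (K X Q : C) (u v : K ~> X) (q : X ~> Q) : Prop :=
  q o u = q o v /\
  forall (T : C) (a : X ~> T), a o u = a o v -> exists! t : Q ~> T, t o q = a.

Definition is_kernel_pair (X Y K : C) (f : X ~> Y) (u v : K ~> X) : Prop :=
  is_pullback f f u v.

Definition regular_epi (X Y : C) (f : X ~> Y) : Prop :=
  exists (K : C) (u v : K ~> X), is_coequalizer u v f.

(* The first two clauses say that the category is finitely complete. *)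
Record is_regular : Prop := IsRegular {
  has_terminal : exists T : C, is_terminal T;
  has_pullbacks : forall (X Y Z : C) (f : X ~> Z) (g : Y ~> Z),
    exists (P : C) (p : P ~> X) (q : P ~> Y), is_pullback f g p q;
  has_kernel_pair_coequalizers :
    forall (X Y K : C) (f : X ~> Y) (u v : K ~> X), is_kernel_pair f u v ->
    exists (Q : C) (q : X ~> Q), is_coequalizer u v q;
  regular_epi_stable :
    forall (X Y Z P : C) (f : X ~> Z) (g : Y ~> Z) (p : P ~> X) (q : P ~> Y),
    is_pullback f g p q -> regular_epi f -> regular_epi q
}.

(* A subobject of X * Y, presented by its two (jointly monic) legs. *)
Record relation (X Y : C) : Type := Relation {
  apex : C;
  leg1 : apex ~> X;
  leg2 : apex ~> Y;
  jointly_monic : forall (T : C) (a b : T ~> apex),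
    leg1 o a = leg1 o b -> leg2 o a = leg2 o b -> a = b
}.

Definition rel_le (X Y : C) (R S : relation X Y) : Prop :=
  exists t : apex R ~> apex S, leg1 S o t = leg1 R /\ leg2 S o t = leg2 R.

(* Equality as subobjects; jointly monic legs make the two comparison
   morphisms mutually inverse. *)
Definition rel_eq (X Y : C) (R S : relation X Y) : Prop :=
  rel_le R S /\ rel_le S R.

(* T is the composite "first R, then S": the regular image in X * Z of the
   pullback of R and S over Y.  Composition is a ternary predicate because
   composites are only determined up to rel_eq; they exist in every regular
   category, see composite_exists below. *)
Definition is_composite (X Y Z : C) (R : relation X Y) (S : relation Y Z)
    (T : relation X Z) : Prop :=
  exists (P : C) (p : P ~> apex R) (q : P ~> apex S) (e : P ~> apex T),
    is_pullback (leg2 R) (leg1 S) p q /\ regular_epi e /\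
    leg1 T o e = leg1 R o p /\ leg2 T o e = leg2 S o q.

Record is_equivalence (X : C) (R : relation X X) : Prop := IsEquivalence {
  equiv_refl : exists r : X ~> apex R, leg1 R o r = idm X /\ leg2 R o r = idm X;
  equiv_sym : exists s : apex R ~> apex R,
    leg1 R o s = leg2 R /\ leg2 R o s = leg1 R;
  equiv_trans : forall (P : C) (p q : P ~> apex R),
    is_pullback (leg2 R) (leg1 R) p q ->
    exists t : P ~> apex R, leg1 R o t = leg1 R o p /\ leg2 R o t = leg2 R o q
}.

Definition is_effective_equivalence (X : C) (R : relation X X) : Prop :=
  is_equivalence R /\
  exists (Y : C) (f : X ~> Y), is_kernel_pair f (leg1 R) (leg2 R).

Definition three_permutable (X : C) (R S : relation X X) : Prop :=
  forall RS RSR SR SRS : relation X X,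
    is_composite R S RS -> is_composite RS R RSR ->
    is_composite S R SR -> is_composite SR S SRS ->
    rel_eq RSR SRS.

Definition goursat : Prop :=
  forall (X : C) (R S : relation X X),
    is_equivalence R -> is_equivalence S -> three_permutable R S.

Definition effective_goursat : Prop :=
  forall (X : C) (R S : relation X X),
    is_effective_equivalence R -> is_effective_equivalence S ->
    three_permutable R S.

Definition split_by (X Y : C) (f : X ~> Y) (i : Y ~> X) : Prop := f o i = idm Y.

(* A morphism of split epimorphisms from (f, i) to (g, j). *)
Definition split_square (X Y U W : C) (f : X ~> Y) (i : Y ~> X)
    (g : U ~> W) (j : W ~> U) (alpha : X ~> U) (beta : Y ~> W) : Prop :=
  g o alpha = beta o f /\ alpha o i = j o beta.

Definition comparison_condition : Prop :=
  forall (X Y Z U V W : C)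
    (f : X ~> Y) (i : Y ~> X) (l : Z ~> Y) (k : Y ~> Z)
    (g : U ~> W) (j : W ~> U) (h : V ~> W) (m : W ~> V)
    (alpha : X ~> U) (beta : Y ~> W) (gamma : Z ~> V),
  split_by f i -> split_by l k -> split_by g j -> split_by h m ->
  regular_epi alpha -> regular_epi beta -> regular_epi gamma ->
  split_square f i g j alpha beta -> split_square l k h m gamma beta ->
  forall (P : C) (piX : P ~> X) (piZ : P ~> Z)
    (Q : C) (piU : Q ~> U) (piV : Q ~> V) (lambda : P ~> Q),
  is_pullback f l piX piZ -> is_pullback g h piU piV ->
  piU o lambda = alpha o piX -> piV o lambda = gamma o piZ ->
  regular_epi lambda.

(* sX and sZ are the sections <1, k f> and <i l, 1> of the two projections. *)
Definition cube_condition : Prop :=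
  forall (X Y Z U V W : C)
    (f : X ~> Y) (i : Y ~> X) (l : Z ~> Y) (k : Y ~> Z)
    (P : C) (piX : P ~> X) (piZ : P ~> Z) (sX : X ~> P) (sZ : Z ~> P)
    (g : U ~> W) (j : W ~> U) (h : V ~> W) (m : W ~> V)
    (A : C) (a : A ~> U) (s : U ~> A) (b : A ~> V) (t : V ~> A)
    (alpha : X ~> U) (beta : Y ~> W) (gamma : Z ~> V) (delta : P ~> A),
  split_by f i -> split_by l k -> is_pullback f l piX piZ ->
  piX o sX = idm X -> piZ o sX = k o f ->
  piX o sZ = i o l -> piZ o sZ = idm Z ->
  split_by g j -> split_by h m -> split_by a s -> split_by b t ->
  g o a = h o b -> s o j = t o m ->
  regular_epi alpha -> regular_epi beta -> regular_epi gamma ->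
  regular_epi delta ->
  split_square f i g j alpha beta -> split_square l k h m gamma beta ->
  split_square piX sX a s delta alpha -> split_square piZ sZ b t delta gamma ->
  is_pullback g h a b.

Lemma regular_epi_epi (X Y T : C) (f : X ~> Y) (a b : Y ~> T) :
  regular_epi f -> a o f = b o f -> a = b.
Proof.
intros [K [u [v [E U]]]] H.
destruct (U T (b o f)) as [t [_ Ht]].
{ rewrite <- !comp_assoc; rewrite E; reflexivity. }
rewrite <- (Ht a H); apply Ht; reflexivity.
Qed.

Lemma composite_exists (X Y Z : C) (R : relation X Y) (S : relation Y Z) :
  is_regular -> exists T : relation X Z, is_composite R S T.
Proof.
intros reg.
destruct (has_terminal reg) as [One HOne].
destruct (HOne X) as [tX _]; destruct (HOne Z) as [tZ _].
destruct (has_pullbacks reg tX tZ) as [XZ [p1 [p2 [_ HXZ]]]].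
destruct (has_pullbacks reg (leg2 R) (leg1 S)) as [P [p [q HP]]].
destruct (HXZ P (leg1 R o p) (leg2 S o q)) as [f [[f1 f2] _]].
{ destruct (HOne P) as [t [_ Ht]].
  rewrite <- (Ht (tX o (leg1 R o p)) I); apply Ht; exact I. }
destruct (has_pullbacks reg f f) as [K [u [v HK]]].
destruct (has_kernel_pair_coequalizers reg HK) as [Q [e He]].
assert (Re : regular_epi e) by (exists K, u, v; exact He).
destruct He as [Euv Ue]; destruct HK as [Efuv UK].
destruct (Ue XZ f Efuv) as [n [Hn _]].
assert (mono : forall (T : C) (a b : T ~> Q),
  (p1 o n) o a = (p1 o n) o b -> (p2 o n) o a = (p2 o n) o b -> a = b).
{ intros T a b H1 H2.
  assert (H : n o a = n o b).
  { destruct (HXZ T (p1 o (n o b)) (p2 o (n o b))) as [t [_ Ht]].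
    { destruct (HOne T) as [t0 [_ Ht0]].
      rewrite <- (Ht0 (tX o (p1 o (n o b))) I); apply Ht0; exact I. }
    rewrite <- (Ht (n o a)).
    - apply Ht; split; reflexivity.
    - rewrite !comp_assoc; split; assumption. }
  destruct (has_pullbacks reg e a) as [T1 [x1 [e1 B1]]].
  destruct (has_pullbacks reg e (b o e1)) as [T2 [x2 [e2 B2]]].
  assert (Re1 := regular_epi_stable reg B1 Re).
  assert (Re2 := regular_epi_stable reg B2 Re).
  destruct B1 as [B1 _]; destruct B2 as [B2 _].
  destruct (UK T2 (x1 o e2) x2) as [w [[w1 w2] _]].
  { rewrite <- Hn, <- !comp_assoc, B2, (comp_assoc e x1 e2), B1.
    rewrite !comp_assoc, H; reflexivity. }
  apply (regular_epi_epi Re1); apply (regular_epi_epi Re2).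
  rewrite <- B1, <- B2, <- w2, <- comp_assoc, <- w1.
  rewrite !comp_assoc, Euv; reflexivity. }
exists (Relation mono), P, p, q, e; simpl.
rewrite <- !comp_assoc, Hn; auto.
Qed.

End Notions.

(* Main.v *)
Require Import Defs.

(** In a regular category, statements about regular epimorphisms and composites
    of relations can be checked on generalized elements, as in sets, at the
    price of restricting along covers, i.e. regular epimorphisms
    ([regular_epi_lift], [regular_epi_of_cover], [related_descent]).  The
    arguments below are written in that language.

    From 3-permutability to the comparison morphism.  Let [(u, v)] be an element
    of the pullback of [g] and [h], and choose locally [x] over [u] and [z] over
    [v].  In general [f x] and [l z] differ, so [(x, z)] is not in the pullback
    [P] of [f] and [l]; but [P] contains the chain
      [(x, k f x), (i f x, k f x), (i l z, k l z), (i l z, z)].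
    Its outer steps are in the kernel pair of the map [P -> Y], and its middle
    step is in the kernel pair of [lambda], because [beta f x = beta l z].
    Permuting the two kernel pairs gives [p] and [q] in [P] with the same image
    in [Y], such that [lambda p] is the value of [lambda] on the first element
    of the chain and [lambda q] its value on the last one.  Then
    [(piX p, piZ q)] is in [P] and lies over [(u, v)].  Kernel pairs are all
    that is used, so effective 3-permutability is enough.

    From the comparison morphism to 3-permutability of all equivalence
    relations.  If [e] is a regular epimorphism from an equivalence relation on
    [B] to its image [R] along a regular epimorphism from [B] to [X], then the
    comparison condition says that composable pairs of [R] lift locally to
    composable pairs upstairs; so [R] is transitive ([direct_image_trans]).  The
    composite [RSR] is such an image: pull [S] back along one leg of [R] and take
    the image along the other leg.  Hence [RSR] is transitive; it contains [R]
    and [S], so it contains [SRS].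

    From the comparison morphism to the cube condition.  The map from [A] to the
    pullback of [g] and [h] is a regular epimorphism, since its composite with
    [delta] is the comparison morphism.  It remains to see that [a] and [b] are
    jointly monic.  Two elements of [A] with the same image under [a] lift
    locally to elements of [P] with the same first projection; if they also
    agree under [b], then pushing these lifts along the section [sZ] of [piZ]
    completes a rectangle whose far side is collapsed by [delta], and the
    shifting lemma ([shifting_lemma]), which holds in the presence of
    3-permutability, shows that the near side is collapsed as well.

    Conversely, the image of the comparison morphism inherits sections from the
    pullback that contains it, so it forms the right face of a cube; the cube
    condition then identifies it with the whole pullback. *)

Set Implicit Arguments.
Unset Strict Implicit.
Unset Printing Implicit Defensive.

(** * Morphisms and pullbacks *)

Lemma precompose (C : category) (X Y Z T : C) (g : Y ~> Z) (f : X ~> Y)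
  (h : X ~> Z) (H : g o f = h) (x : T ~> X) : g o (f o x) = h o x.
Proof. rewrite comp_assoc, H; reflexivity. Qed.

Lemma precompose_square (C : category) (X Y Y' Z T : C) (g : Y ~> Z)
  (f : X ~> Y) (g' : Y' ~> Z) (f' : X ~> Y') (H : g o f = g' o f')
  (x : T ~> X) : g o (f o x) = g' o (f' o x).
Proof. rewrite !comp_assoc, H; reflexivity. Qed.

Lemma pullback_pair (C : category) (X Y Z P : C) (f : X ~> Z) (g : Y ~> Z)
  (p : P ~> X) (q : P ~> Y) (T : C) (a : T ~> X) (b : T ~> Y) :
  is_pullback f g p q -> f o a = g o b ->
  exists t : T ~> P, p o t = a /\ q o t = b.
Proof.
intros [_ U] H; destruct (U T a b H) as [t [Ht _]]; exists t; exact Ht.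
Qed.

Lemma pullback_jointly_monic (C : category) (X Y Z P : C) (f : X ~> Z)
  (g : Y ~> Z) (p : P ~> X) (q : P ~> Y) (T : C) (a b : T ~> P) :
  is_pullback f g p q -> p o a = p o b -> q o a = q o b -> a = b.
Proof.
intros [E U] H1 H2.
destruct (U T (p o b) (q o b) (precompose_square E b)) as [t [_ Ht]].
rewrite <- (Ht a (conj H1 H2)); apply Ht; split; reflexivity.
Qed.

Definition monic (C : category) (X Y : C) (n : X ~> Y) : Prop :=
  forall (T : C) (a b : T ~> X), n o a = n o b -> a = b.

(** * Regular epimorphisms as covers *)

Lemma regular_epi_idm (C : category) (X : C) : regular_epi (idm X).
Proof.
exists X, (idm X), (idm X); split; [reflexivity|].
intros T a _; exists a; split; [apply comp_idr|].
intros b <-; apply comp_idr.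
Qed.

(** A regular epimorphism [q] is orthogonal to jointly monic pairs: the pair
    sees that [e] equalizes the two arrows of which [q] is the coequalizer. *)
Lemma regular_epi_diagonal (C : category) (B X Y Z R : C) (q : B ~> X)
  (e : B ~> R) (m : R ~> Y) (n : R ~> Z) (y : X ~> Y) (z : X ~> Z) :
  regular_epi q ->
  (forall (T : C) (a b : T ~> R), m o a = m o b -> n o a = n o b -> a = b) ->
  m o e = y o q -> n o e = z o q ->
  exists d : X ~> R, d o q = e /\ m o d = y /\ n o d = z.
Proof.
intros Rq mono H1 H2.
pose proof Rq as [K [u [v [Euv U]]]].
destruct (U R e) as [d [Hd _]].
{ apply mono.
  - rewrite (precompose_square H1), Euv, (precompose_square H1); reflexivity.
  - rewrite (precompose_square H2), Euv, (precompose_square H2); reflexivity. }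
exists d; repeat split; [exact Hd| |];
  apply (regular_epi_epi Rq); rewrite <- comp_assoc, Hd; assumption.
Qed.

Lemma regular_epi_diagonal_monic (C : category) (B X Y R : C) (q : B ~> X)
  (e : B ~> R) (n : R ~> Y) (y : X ~> Y) :
  regular_epi q -> monic n -> n o e = y o q ->
  exists d : X ~> R, d o q = e /\ n o d = y.
Proof.
intros Rq mono H.
destruct (@regular_epi_diagonal C B X Y Y R q e n n y y) as [d [H1 [H2 _]]];
  auto.
exists d; auto.
Qed.

(** For generalized elements, a regular epimorphism behaves as a surjection:
    [y] has a preimage after restriction along the cover [c]. *)
Lemma regular_epi_lift (C : category) (reg : is_regular C) (X Y T : C)
  (f : X ~> Y) (y : T ~> Y) :
  regular_epi f ->
  exists (T' : C) (c : T' ~> T) (x : T' ~> X), regular_epi c /\ f o x = y o c.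
Proof.
intros Rf.
destruct (has_pullbacks reg f y) as [T' [x [c HP]]].
exists T', c, x; split; [exact (regular_epi_stable reg HP Rf) | apply HP].
Qed.

(** The monic part is the factorization through the coequalizer [e] of the
    kernel pair.  It is monic because two elements of the coequalizer lift,
    along covers, to elements of [X]; if they are identified by [n], then their
    lifts form an element of the kernel pair, which [e] collapses. *)
Lemma image_factorization (C : category) (reg : is_regular C) (X Y : C)
  (f : X ~> Y) :
  exists (I : C) (e : X ~> I) (n : I ~> Y),
    regular_epi e /\ monic n /\ n o e = f.
Proof.
destruct (has_pullbacks reg f f) as [K [u [v HK]]].
destruct (has_kernel_pair_coequalizers reg HK) as [I [e He]].
assert (Re : regular_epi e) by (exists K, u, v; exact He).
destruct He as [Euv U].
destruct (U Y f (proj1 HK)) as [n [Hn _]].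
exists I, e, n; repeat split; [exact Re | | exact Hn].
intros T a b H.
destruct (regular_epi_lift reg a Re) as [T1 [c1 [x1 [R1 H1]]]].
destruct (regular_epi_lift reg (b o c1) Re) as [T2 [c2 [x2 [R2 H2]]]].
assert (E : f o (x1 o c2) = f o x2).
{ rewrite <- Hn, <- !comp_assoc, H2, (precompose H1), !comp_assoc, H.
  reflexivity. }
destruct (pullback_pair HK E) as [w [W1 W2]].
apply (regular_epi_epi R1), (regular_epi_epi R2).
rewrite <- H1, <- H2, <- comp_assoc, <- W1, <- W2.
apply (precompose_square Euv).
Qed.

Lemma regular_epi_monic_iso (C : category) (X Y : C) (f : X ~> Y) :
  regular_epi f -> monic f ->
  exists g : Y ~> X, g o f = idm X /\ f o g = idm Y.
Proof.
intros Rf mono; apply (regular_epi_diagonal_monic Rf mono).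
rewrite comp_idl, comp_idr; reflexivity.
Qed.

Lemma regular_epi_comp_iso (C : category) (X Y Z : C) (e : X ~> Y)
  (n : Y ~> Z) (n' : Z ~> Y) :
  regular_epi e -> n' o n = idm Y -> n o n' = idm Z -> regular_epi (n o e).
Proof.
intros [K [u [v [E U]]]] H1 H2.
exists K, u, v; split.
{ rewrite <- !comp_assoc, E; reflexivity. }
intros T a Ha; destruct (U T a Ha) as [t [Ht1 Ht2]].
exists (t o n'); split.
- rewrite <- comp_assoc, (precompose H1), comp_idl; exact Ht1.
- intros s Hs; rewrite (Ht2 (s o n)).
  + rewrite <- comp_assoc, H2; apply comp_idr.
  + rewrite <- comp_assoc; exact Hs.
Qed.

(** Converse of [regular_epi_lift]: it is enough to have preimages locally.
    The cover [c] factors through the monic part of [f], which is therefore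
    a split epimorphism, and so invertible. *)
Lemma regular_epi_of_cover (C : category) (reg : is_regular C) (X Y T : C)
  (f : X ~> Y) (c : T ~> Y) (x : T ~> X) :
  regular_epi c -> f o x = c -> regular_epi f.
Proof.
intros Rc H.
destruct (image_factorization reg f) as [I [e [n [Re [Mn Hn]]]]].
destruct (@regular_epi_diagonal_monic C T Y Y I c (e o x) n (idm Y))
  as [d [_ Hd]]; [exact Rc | exact Mn | |].
{ rewrite (precompose Hn), comp_idl; exact H. }
rewrite <- Hn; apply (regular_epi_comp_iso (n' := d) Re); [|exact Hd].
apply Mn; rewrite (precompose Hd), comp_idl, comp_idr; reflexivity.
Qed.

Lemma regular_epi_comp (C : category) (reg : is_regular C) (X Y Z : C)
  (g : Y ~> Z) (f : X ~> Y) :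
  regular_epi g -> regular_epi f -> regular_epi (g o f).
Proof.
intros Rg Rf.
destruct (image_factorization reg (g o f)) as [I [e [n [Re [Mn Hn]]]]].
destruct (regular_epi_diagonal_monic Rf Mn Hn) as [d [_ Hd]].
destruct (@regular_epi_diagonal_monic C Y Z Z I g d n (idm Z)) as [d' [_ Hd']];
  [exact Rg | exact Mn | rewrite comp_idl; exact Hd |].
rewrite <- Hn; apply (regular_epi_comp_iso (n' := d') Re); [|exact Hd'].
apply Mn; rewrite (precompose Hd'), comp_idl, comp_idr; reflexivity.
Qed.

(** * Relations on generalized elements *)

Definition related (C : category) (X Y : C) (R : relation X Y) (T : C)
  (x : T ~> X) (y : T ~> Y) : Prop :=
  exists t : T ~> apex R, leg1 R o t = x /\ leg2 R o t = y.

Lemma related_restrict (C : category) (X Y : C) (R : relation X Y) (T T' : C)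
  (x : T ~> X) (y : T ~> Y) (c : T' ~> T) :
  related R x y -> related R (x o c) (y o c).
Proof.
intros [t [<- <-]]; exists (t o c); rewrite !comp_assoc; split; reflexivity.
Qed.

Lemma related_descent (C : category) (X Y : C) (R : relation X Y) (T T' : C)
  (x : T ~> X) (y : T ~> Y) (c : T' ~> T) :
  regular_epi c -> related R (x o c) (y o c) -> related R x y.
Proof.
intros Rc [t [H1 H2]].
destruct (regular_epi_diagonal Rc (@jointly_monic _ _ _ R) H1 H2)
  as [d [_ H]].
exists d; exact H.
Qed.

Lemma rel_le_of_related (C : category) (X Y : C) (R S : relation X Y) :
  (forall (T : C) (x : T ~> X) (y : T ~> Y), related R x y -> related S x y) ->
  rel_le R S.
Proof.
intros H; apply H; exists (idm (apex R)); split; apply comp_idr.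
Qed.

Lemma related_of_rel_le (C : category) (X Y : C) (R S : relation X Y) (T : C)
  (x : T ~> X) (y : T ~> Y) : rel_le R S -> related R x y -> related S x y.
Proof.
intros [i [H1 H2]] [t [<- <-]]; exists (i o t).
rewrite (precompose H1), (precompose H2); split; reflexivity.
Qed.

Lemma composite_intro (C : category) (X Y Z : C) (R : relation X Y)
  (S : relation Y Z) (RS : relation X Z) (T : C) (x : T ~> X) (y : T ~> Y)
  (z : T ~> Z) :
  is_composite R S RS -> related R x y -> related S y z -> related RS x z.
Proof.
intros [P [p [q [e [HP [_ [H1 H2]]]]]]] [a [A1 A2]] [b [B1 B2]].
destruct (pullback_pair (a := a) (b := b) HP) as [t [T1 T2]].
{ rewrite A2, B1; reflexivity. }
exists (e o t).
rewrite (precompose_square H1), (precompose_square H2), T1, T2; auto.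
Qed.

(** The intermediate element is only available locally, because a composite
    is a regular image. *)
Lemma composite_elim (C : category) (reg : is_regular C) (X Y Z : C)
  (R : relation X Y) (S : relation Y Z) (RS : relation X Z) (T : C)
  (x : T ~> X) (z : T ~> Z) :
  is_composite R S RS -> related RS x z ->
  exists (T' : C) (c : T' ~> T) (y : T' ~> Y),
    regular_epi c /\ related R (x o c) y /\ related S y (z o c).
Proof.
intros [P [p [q [e [HP [Re [H1 H2]]]]]]] [t [<- <-]].
destruct (regular_epi_lift reg t Re) as [T' [c [s [Rc Hs]]]].
exists T', c, (leg2 R o (p o s)); split; [exact Rc|split].
- exists (p o s); split; [|reflexivity].
  rewrite <- comp_assoc, <- Hs; symmetry; apply (precompose_square H1).
- exists (q o s); split.
  + symmetry; apply (precompose_square (proj1 HP)).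
  + rewrite <- comp_assoc, <- Hs; symmetry; apply (precompose_square H2).
Qed.

Lemma composite3_elim (C : category) (reg : is_regular C) (X1 X2 X3 X4 : C)
  (R : relation X1 X2) (S : relation X2 X3) (Q : relation X3 X4)
  (RS : relation X1 X3) (RSQ : relation X1 X4) (T : C)
  (x : T ~> X1) (z : T ~> X4) :
  is_composite R S RS -> is_composite RS Q RSQ -> related RSQ x z ->
  exists (T' : C) (c : T' ~> T) (y1 : T' ~> X2) (y2 : T' ~> X3),
    regular_epi c /\ related R (x o c) y1 /\ related S y1 y2 /\
    related Q y2 (z o c).
Proof.
intros H1 H2 H.
destruct (composite_elim reg H2 H) as [T1 [c1 [y2 [R1 [A1 A2]]]]].
destruct (composite_elim reg H1 A1) as [T2 [c2 [y1 [R2 [B1 B2]]]]].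
exists T2, (c1 o c2), y1, (y2 o c2).
split; [exact (regular_epi_comp reg R1 R2)|].
rewrite !comp_assoc; repeat split; [exact B1 | exact B2 |].
apply related_restrict; exact A2.
Qed.

Lemma equivalence_refl (C : category) (X : C) (R : relation X X) (T : C)
  (x : T ~> X) : is_equivalence R -> related R x x.
Proof.
intros ER; destruct (equiv_refl ER) as [r [H1 H2]]; exists (r o x).
rewrite (precompose H1), (precompose H2), comp_idl; split; reflexivity.
Qed.

Lemma equivalence_sym (C : category) (X : C) (R : relation X X) (T : C)
  (x y : T ~> X) : is_equivalence R -> related R x y -> related R y x.
Proof.
intros ER [t [<- <-]]; destruct (equiv_sym ER) as [s [H1 H2]]; exists (s o t).
rewrite (precompose H1), (precompose H2); split; reflexivity.
Qed.

Lemma equivalence_trans (C : category) (reg : is_regular C) (X : C)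
  (R : relation X X) (T : C) (x y z : T ~> X) :
  is_equivalence R -> related R x y -> related R y z -> related R x z.
Proof.
intros ER [a [<- A]] [b [B <-]].
destruct (has_pullbacks reg (leg2 R) (leg1 R)) as [P [p [q HP]]].
destruct (equiv_trans ER HP) as [t [H1 H2]].
destruct (pullback_pair (a := a) (b := b) HP) as [w [<- <-]].
{ rewrite A, B; reflexivity. }
exists (t o w).
rewrite (precompose_square H1), (precompose_square H2); split; reflexivity.
Qed.

Lemma kernel_relation (C : category) (reg : is_regular C) (X Y : C)
  (f : X ~> Y) :
  exists R : relation X X, is_effective_equivalence R /\
    forall (T : C) (x y : T ~> X), related R x y <-> f o x = f o y.
Proof.
destruct (has_pullbacks reg f f) as [K [u [v HK]]].
set (R := Relation (fun T a b =>
  @pullback_jointly_monic C X X Y K f f u v T a b HK)).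
assert (HR : forall (T : C) (x y : T ~> X), related R x y <-> f o x = f o y).
{ intros T x y; split.
  - intros [t [<- <-]]; apply (precompose_square (proj1 HK)).
  - intros H; apply (pullback_pair HK H). }
exists R; split; [split; [split|]|exact HR].
- apply HR; reflexivity.
- apply HR; symmetry; apply HK.
- intros P p q HP; apply HR.
  pose proof (proj1 HK) as E.
  change (f o (u o p) = f o (v o q)).
  rewrite (precompose_square E), (proj1 HP : v o p = u o q).
  apply (precompose_square E).
- exists Y, f; exact HK.
Qed.

(** * From 3-permutability to the comparison morphism *)

(** Inclusion of [FGF] in [GFG] for the kernel pairs [F] and [G] of [f] and [g].
    The relations themselves disappear, so that uses of 3-permutability become
    equations between arrows. *)
Lemma effective_goursat_elements (C : category) (reg : is_regular C)
  (X Y Z T : C) (f : X ~> Y) (g : X ~> Z) (x0 x1 x2 x3 : T ~> X) :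
  effective_goursat C ->
  f o x0 = f o x1 -> g o x1 = g o x2 -> f o x2 = f o x3 ->
  exists (T' : C) (c : T' ~> T) (y1 y2 : T' ~> X), regular_epi c /\
    g o (x0 o c) = g o y1 /\ f o y1 = f o y2 /\ g o y2 = g o (x3 o c).
Proof.
intros EG H0 H1 H2.
destruct (kernel_relation reg f) as [R [ER HR]].
destruct (kernel_relation reg g) as [S [ES HS]].
destruct (composite_exists R S reg) as [RS C1].
destruct (composite_exists RS R reg) as [RSR C2].
destruct (composite_exists S R reg) as [SR C3].
destruct (composite_exists SR S reg) as [SRS C4].
destruct (EG X R S ER ES RS RSR SR SRS C1 C2 C3 C4) as [le _].
assert (H : related SRS x0 x3).
{ apply (related_of_rel_le le), (composite_intro (y := x2) C2);
    [apply (composite_intro (y := x1) C1)|];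
    [apply HR | apply HS | apply HR]; assumption. }
destruct (composite3_elim reg C3 C4 H)
  as [T' [c [y1 [y2 [Rc [A1 [A2 A3]]]]]]].
exists T', c, y1, y2; split; [exact Rc|].
repeat split; [apply HS | apply HR | apply HS]; assumption.
Qed.

Lemma comparison_of_effective_goursat (C : category) (reg : is_regular C) :
  effective_goursat C -> comparison_condition C.
Proof.
intros EG X Y Z U V W f i l k g j h m alpha beta gamma Sf Sl Sg Sh
  Ra Rb Rc [Ea1 Ea2] [Ec1 Ec2] P piX piZ Q piU piV lambda HP HQ L1 L2.
unfold split_by in *.
destruct (regular_epi_lift reg piU Ra) as [T1 [c1 [x1 [R1 H1]]]].
destruct (regular_epi_lift reg (piV o c1) Rc) as [T [c2 [z [R2 H2]]]].
set (x := x1 o c2).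
set (c := c1 o c2).
assert (Hx : alpha o x = piU o c).
{ unfold x, c; rewrite (precompose H1), comp_assoc; reflexivity. }
assert (Hz : gamma o z = piV o c).
{ unfold c; rewrite H2, comp_assoc; reflexivity. }
assert (Hb : beta o (f o x) = beta o (l o z)).
{ rewrite <- (precompose_square Ea1), <- (precompose_square Ec1), Hx, Hz.
  apply (precompose_square (proj1 HQ)). }
(* The chain [(x, k f x), (i f x, k f x), (i l z, k l z), (i l z, z)]. *)
destruct (@pullback_pair C X Z Y P f l piX piZ T x (k o (f o x)) HP)
  as [e0 [A0 B0]].
{ rewrite (precompose Sl), comp_idl; reflexivity. }
destruct (@pullback_pair C X Z Y P f l piX piZ T (i o (f o x)) (k o (f o x)) HP)
  as [e1 [A1 B1]].
{ rewrite (precompose Sl), (precompose Sf); reflexivity. }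
destruct (@pullback_pair C X Z Y P f l piX piZ T (i o (l o z)) (k o (l o z)) HP)
  as [e2 [A2 B2]].
{ rewrite (precompose Sl), (precompose Sf); reflexivity. }
destruct (@pullback_pair C X Z Y P f l piX piZ T (i o (l o z)) z HP)
  as [e3 [A3 B3]].
{ rewrite (precompose Sf), comp_idl; reflexivity. }
destruct (@effective_goursat_elements C reg P Y Q T (f o piX) lambda
  e0 e1 e2 e3 EG) as [T' [d [p [q [Rd [D1 [D2 D3]]]]]]].
{ rewrite <- !comp_assoc, A0, A1, (precompose Sf), comp_idl; reflexivity. }
{ apply (pullback_jointly_monic HQ).
  - rewrite !(precompose_square L1), A1, A2, !(precompose_square Ea2), Hb.
    reflexivity.
  - rewrite !(precompose_square L2), B1, B2, !(precompose_square Ec2), Hb.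
    reflexivity. }
{ rewrite <- !comp_assoc, A2, A3; reflexivity. }
(* The element over [(u, v)] mixes the two intermediate elements: [p] is right
   on the side of [X], and [q] on the side of [Z]. *)
destruct (@pullback_pair C X Z Y P f l piX piZ T' (piX o p) (piZ o q) HP)
  as [w [W1 W2]].
{ rewrite <- (precompose_square (proj1 HP)), !comp_assoc; exact D2. }
apply (regular_epi_of_cover (c := c o d) (x := w) reg).
{ apply regular_epi_comp; [exact reg | | exact Rd].
  apply regular_epi_comp; assumption. }
apply (pullback_jointly_monic HQ).
- rewrite (precompose_square L1), W1, <- (precompose_square L1), <- D1.
  rewrite (precompose_square L1), (precompose A0), comp_assoc, Hx, comp_assoc.
  reflexivity.
- rewrite (precompose_square L2), W2, <- (precompose_square L2), D3.
  rewrite (precompose_square L2), (precompose B3), comp_assoc, Hz, comp_assoc.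
  reflexivity.
Qed.

(** * From the comparison morphism to 3-permutability *)

(** Both pullbacks of the comparison condition are taken to be objects of
    composable pairs: of the span [(d0, d1)] on one side and of its image [R] on
    the other, split by reflexivity.  That [lambda] is a regular epimorphism
    then says that composable pairs of [R] lift locally, and transitivity is
    transported along [e]. *)
Lemma direct_image_trans (C : category) (reg : is_regular C) (B X D : C)
  (d0 d1 : D ~> B) (r : B ~> D) (beta : B ~> X) (R : relation X X)
  (e : D ~> apex R) :
  comparison_condition C ->
  d0 o r = idm B -> d1 o r = idm B ->
  (forall (T : C) (a b : T ~> D), d1 o a = d0 o b ->
    exists t : T ~> D, d0 o t = d0 o a /\ d1 o t = d1 o b) ->
  regular_epi beta -> regular_epi e ->
  leg1 R o e = beta o d0 -> leg2 R o e = beta o d1 ->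
  forall (T : C) (x y z : T ~> X),
    related R x y -> related R y z -> related R x z.
Proof.
intros CC H0 H1 trans Rb Re E0 E1 T x y z [s [<- S2]] [t [T1 <-]].
(* [R] inherits reflexivity from the span, because [beta] is a cover. *)
destruct (@regular_epi_diagonal C B X X X (apex R) beta (e o r)
  (leg1 R) (leg2 R) (idm X) (idm X)) as [j [J0 [J1 J2]]].
{ exact Rb. }
{ apply jointly_monic. }
{ rewrite (precompose_square E0), H0, comp_idl; apply comp_idr. }
{ rewrite (precompose_square E1), H1, comp_idl; apply comp_idr. }
destruct (has_pullbacks reg d1 d0) as [P [p [q HP]]].
destruct (has_pullbacks reg (leg2 R) (leg1 R)) as [Q [p' [q' HQ]]].
destruct (@pullback_pair _ _ _ _ _ _ _ _ _ P (e o p) (e o q) HQ)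
  as [lambda [L1 L2]].
{ rewrite (precompose_square E0), (precompose_square E1), (proj1 HP).
  reflexivity. }
assert (Rl : regular_epi lambda).
{ apply (CC D B D (apex R) (apex R) X d1 r d0 r (leg2 R) j (leg1 R) j
    e beta e) with (P := P) (piX := p) (piZ := q) (piU := p') (piV := q');
    try assumption; split; auto. }
destruct (@pullback_pair _ _ _ _ _ _ _ _ _ T s t HQ) as [w [W1 W2]].
{ rewrite S2, T1; reflexivity. }
destruct (regular_epi_lift reg w Rl) as [T' [c [v [Rc Hv]]]].
destruct (trans T' (p o v) (q o v)) as [u [U1 U2]].
{ apply (precompose_square (proj1 HP)). }
apply (related_descent Rc).
exists (e o u); split.
- rewrite (precompose_square E0), U1, <- (precompose_square E0).
  rewrite <- (precompose_square L1), Hv, (precompose W1), comp_assoc.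
  reflexivity.
- rewrite (precompose_square E1), U2, <- (precompose_square E1).
  rewrite <- (precompose_square L2), Hv, (precompose W2), comp_assoc.
  reflexivity.
Qed.

(** [RSR] is the image, along [leg1 R], of the inverse image of [S] along
    [leg2 R]: two elements are related by [RSR] when they have [R]-related
    partners that are related by [S].  The inverse image of [S] is transitive
    and [leg1 R] is a split epimorphism, so [direct_image_trans] applies. *)
Lemma composite3_trans (C : category) (reg : is_regular C) (X : C)
  (R S RS RSR : relation X X) :
  comparison_condition C -> is_equivalence R -> is_equivalence S ->
  is_composite R S RS -> is_composite RS R RSR ->
  forall (T : C) (x y z : T ~> X),
    related RSR x y -> related RSR y z -> related RSR x z.
Proof.
intros CC ER ES C1 C2.
(* [M] is the inverse image of [S]: triples of [r], [s] and [r'] with [s] going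
   from [leg2 r] to [leg2 r']. *)
destruct (has_pullbacks reg (leg2 R) (leg1 S)) as [N [n1 [n2 HN]]].
destruct (has_pullbacks reg (leg2 S o n2) (leg2 R)) as [M [m1 [m2 HM]]].
set (d0 := n1 o m1).
assert (mk : forall (T : C) (a b : T ~> apex R),
  related S (leg2 R o a) (leg2 R o b) ->
  exists t : T ~> M, d0 o t = a /\ m2 o t = b).
{ intros T a b [s [S1 S2]].
  destruct (@pullback_pair _ _ _ _ _ _ _ _ _ T a s HN) as [t [T1 T2]].
  { auto. }
  destruct (@pullback_pair _ _ _ _ _ _ _ _ _ T t b HM) as [t' [T3 T4]].
  { rewrite <- comp_assoc, T2; exact S2. }
  exists t'; split; [|exact T4].
  unfold d0; rewrite <- comp_assoc, T3; exact T1. }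
assert (un : forall (T : C) (t : T ~> M),
  related S (leg2 R o (d0 o t)) (leg2 R o (m2 o t))).
{ intros T t; exists (n2 o (m1 o t)); split.
  - unfold d0; rewrite <- (precompose_square (proj1 HN)), <- comp_assoc.
    reflexivity.
  - rewrite <- (precompose_square (proj1 HM)), <- comp_assoc; reflexivity. }
destruct (mk (apex R) (idm _) (idm _)) as [r [r0 r1]].
{ apply equivalence_refl; exact ES. }
assert (E : related RSR (leg1 R o d0) (leg1 R o m2)).
{ apply (composite_intro (y := leg2 R o m2) C2);
    [apply (composite_intro (y := leg2 R o d0) C1)|].
  - exists d0; auto.
  - generalize (un M (idm M)); rewrite !comp_idr; auto.
  - apply equivalence_sym; [exact ER|]; exists m2; auto. }
destruct E as [e [E0 E1]].
assert (Re : regular_epi e).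
{ destruct (@composite3_elim C reg X X X X R S R RS RSR (apex RSR)
    (leg1 RSR) (leg2 RSR) C1 C2) as [T [c [y1 [y2 [Rc [A1 [A2 A3]]]]]]].
  { exists (idm _); split; apply comp_idr. }
  destruct A1 as [a [a1 <-]].
  apply (equivalence_sym ER) in A3; destruct A3 as [b [b1 <-]].
  destruct (mk T a b A2) as [t [t0 t1]].
  apply (regular_epi_of_cover (c := c) (x := t) reg Rc).
  apply jointly_monic.
  - rewrite (precompose_square E0), t0; exact a1.
  - rewrite (precompose_square E1), t1; exact b1. }
apply (direct_image_trans reg (d0 := d0) (d1 := m2) (r := r) (beta := leg1 R)
  (e := e)); try assumption.
- intros T a b H; apply mk.
  apply (equivalence_trans (y := leg2 R o (m2 o a)) reg ES); [apply un|].
  rewrite H; apply un.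
- destruct (equiv_refl ER) as [s [Hs _]].
  apply (regular_epi_of_cover (c := idm X) (x := s) reg);
    [apply regular_epi_idm | exact Hs].
Qed.

(** Reflexivity puts [SR] and [S] inside the transitive relation [RSR]. *)
Lemma composite3_le (C : category) (reg : is_regular C) (X : C)
  (R S RS RSR SR SRS : relation X X) :
  comparison_condition C -> is_equivalence R -> is_equivalence S ->
  is_composite R S RS -> is_composite RS R RSR ->
  is_composite S R SR -> is_composite SR S SRS -> rel_le SRS RSR.
Proof.
intros CC ER ES C1 C2 C3 C4; apply rel_le_of_related; intros T x z H.
destruct (composite3_elim reg C3 C4 H) as [T' [c [y1 [y2 [Rc [A1 [A2 A3]]]]]]].
apply (related_descent Rc).
apply (composite3_trans (y := y2) reg CC ER ES C1 C2).
- apply (composite_intro (y := y1) C2); [|exact A2].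
  apply (composite_intro (y := x o c) C1); [|exact A1].
  apply equivalence_refl; exact ER.
- apply (composite_intro (y := z o c) C2); [|apply equivalence_refl; exact ER].
  apply (composite_intro (y := y2) C1); [|exact A3].
  apply equivalence_refl; exact ER.
Qed.

Lemma goursat_of_comparison (C : category) (reg : is_regular C) :
  comparison_condition C -> goursat C.
Proof.
intros CC X R S ER ES RS RSR SR SRS C1 C2 C3 C4; split.
- exact (composite3_le reg CC ES ER C3 C4 C1 C2).
- exact (composite3_le reg CC ER ES C1 C2 C3 C4).
Qed.

Lemma effective_goursat_of_goursat (C : category) :
  goursat C -> effective_goursat C.
Proof. intros G X R S [ER _] [ES _]; apply G; assumption. Qed.

(** * The cube condition *)

(** The comparison condition for two copies of the same split epimorphism says
    that the induced morphism between kernel pairs is a regular epimorphism. *)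
Lemma split_square_kernel_lift (C : category) (reg : is_regular C)
  (X Y U W : C) (f : X ~> Y) (i : Y ~> X) (g : U ~> W) (j : W ~> U)
  (alpha : X ~> U) (beta : Y ~> W) (T : C) (u u' : T ~> U) :
  comparison_condition C -> split_by f i -> split_by g j ->
  regular_epi alpha -> regular_epi beta -> split_square f i g j alpha beta ->
  g o u = g o u' ->
  exists (T' : C) (c : T' ~> T) (x x' : T' ~> X), regular_epi c /\
    f o x = f o x' /\ alpha o x = u o c /\ alpha o x' = u' o c.
Proof.
intros CC Sf Sg Ra Rb Sq Hu.
destruct (has_pullbacks reg f f) as [K [k1 [k2 HK]]].
destruct (has_pullbacks reg g g) as [L [l1 [l2 HL]]].
destruct (@pullback_pair _ _ _ _ _ _ _ _ _ K (alpha o k1) (alpha o k2) HL)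
  as [kappa [K1 K2]].
{ rewrite !(precompose_square (proj1 Sq)), (proj1 HK); reflexivity. }
assert (Rk : regular_epi kappa) by
  exact (CC _ _ _ _ _ _ _ _ _ _ _ _ _ _ _ _ _ Sf Sf Sg Sg Ra Rb Ra Sq Sq
    _ _ _ _ _ _ _ HK HL K1 K2).
destruct (pullback_pair HL Hu) as [w [<- <-]].
destruct (regular_epi_lift reg w Rk) as [T' [c [v [Rc Hv]]]].
exists T', c, (k1 o v), (k2 o v); repeat split; [exact Rc | | |].
- apply (precompose_square (proj1 HK)).
- rewrite <- (precompose_square K1), Hv, comp_assoc; reflexivity.
- rewrite <- (precompose_square K2), Hv, comp_assoc; reflexivity.
Qed.

(** The elements form a rectangle, with horizontal sides [p1 p2] and [q1 q2]
    in the kernel pair of [piX] and vertical sides in the kernel pair of [piZ].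
    Let [F] be the kernel pair of [piZ] and [G] the intersection of those of
    [delta] and [piX].  Then [p1] and [p2] are joined by [FGF], hence by [GFG].
    All steps of the new chain preserve [piX]: the outer ones by the choice of
    [G], the middle one because [p1] and [p2] agree under [piX].  So the middle
    step is an equality, and the outer ones show [delta p1 = delta p2]. *)
Lemma shifting_lemma (C : category) (reg : is_regular C) (P X Z A U T : C)
  (piX : P ~> X) (piZ : P ~> Z) (delta : P ~> A) (a : A ~> U) (alpha : X ~> U)
  (p1 p2 q1 q2 : T ~> P) :
  effective_goursat C ->
  (forall (S : C) (s t : S ~> P), piX o s = piX o t -> piZ o s = piZ o t ->
    s = t) ->
  a o delta = alpha o piX ->
  piX o p1 = piX o p2 -> piX o q1 = piX o q2 ->
  piZ o p1 = piZ o q1 -> piZ o p2 = piZ o q2 ->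
  delta o q1 = delta o q2 -> delta o p1 = delta o p2.
Proof.
intros EG mono Ha HX HX' HZ HZ' Hq.
(* [delta] and [piX] agree over [U], so they can be paired into a pullback over
   [U]; the kernel pair of that single map [rho] is [G]. *)
destruct (has_pullbacks reg a alpha) as [B [b1 [b2 HB]]].
destruct (pullback_pair HB Ha) as [rho [R1 R2]].
destruct (@effective_goursat_elements C reg P Z B T piZ rho p1 q1 q2 p2 EG)
  as [T' [c [p [p' [Rc [H1 [H2 H3]]]]]]]; [exact HZ | | auto |].
{ apply (pullback_jointly_monic HB).
  - rewrite !(precompose R1); exact Hq.
  - rewrite !(precompose R2); exact HX'. }
(* [p] and [p'] agree under [piZ], being the two ends of the [F]-step. *)
assert (E : p = p').
{ apply mono; [|exact H2].
  rewrite <- R2, <- !comp_assoc, H3, <- H1, !(precompose R2), !comp_assoc, HX.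
  reflexivity. }
subst p'.
apply (regular_epi_epi Rc).
rewrite <- !comp_assoc, <- R1, <- !comp_assoc, H1, H3; reflexivity.
Qed.

Lemma cube_of_comparison (C : category) (reg : is_regular C) :
  comparison_condition C -> cube_condition C.
Proof.
intros CC X Y Z U V W f i l k P piX piZ sX sZ g j h m A a s b t
  alpha beta gamma delta Sf Sl HP PX1 PX2 PZ1 PZ2 Sg Sh Sa Sb Hab Hst
  Ra Rb Rc Rd Qf Ql QX QZ.
pose proof (effective_goursat_of_goursat (goursat_of_comparison reg CC)) as EG.
assert (mono : forall (T : C) (w w' : T ~> A),
  a o w = a o w' -> b o w = b o w' -> w = w').
{ intros T w w' Hw Hw'.
  destruct (split_square_kernel_lift reg CC (PX1 : split_by piX sX) Sa Rd Ra
    QX Hw) as [T' [c [p [p' [Rc' [E1 [E2 E3]]]]]]].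
  apply (regular_epi_epi Rc'); rewrite <- E2, <- E3.
  apply (shifting_lemma (q1 := sZ o (piZ o p)) (q2 := sZ o (piZ o p')) reg EG
    (fun T s t => @pullback_jointly_monic C _ _ _ _ _ _ _ _ T s t HP)
    (proj1 QX)).
  - exact E1.
  - rewrite !(precompose_square PZ1), <- !(precompose_square (proj1 HP)), E1.
    reflexivity.
  - rewrite (precompose PZ2), comp_idl; reflexivity.
  - rewrite (precompose PZ2), comp_idl; reflexivity.
  - rewrite !(precompose_square (proj2 QZ)), <- !(precompose_square (proj1 QZ)).
    rewrite E2, E3, (precompose_square Hw'); reflexivity. }
destruct (has_pullbacks reg g h) as [Q [piU [piV HQ]]].
destruct (pullback_pair HQ Hab) as [n [N1 N2]].
assert (Rl : regular_epi (n o delta)).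
{ apply (CC X Y Z U V W f i l k g j h m alpha beta gamma) with
    (P := P) (piX := piX) (piZ := piZ) (piU := piU) (piV := piV);
    try assumption.
  - rewrite (precompose N1); apply QX.
  - rewrite (precompose N2); apply QZ. }
destruct (@regular_epi_monic_iso C A Q n) as [n' [_ I2]].
{ apply (regular_epi_of_cover reg Rl (x := delta)); reflexivity. }
{ intros T w w' H; apply mono.
  - rewrite <- N1, <- !comp_assoc, H; reflexivity.
  - rewrite <- N2, <- !comp_assoc, H; reflexivity. }
split; [exact Hab|].
intros T u v Huv; destruct (pullback_pair HQ Huv) as [q [<- <-]].
assert (G : a o (n' o q) = piU o q /\ b o (n' o q) = piV o q).
{ rewrite <- N1, <- N2, <- !comp_assoc, (precompose I2), comp_idl; auto. }
exists (n' o q); split; [exact G|].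
intros w [W1 W2]; destruct G as [G1 G2]; apply mono.
- rewrite G1, W1; reflexivity.
- rewrite G2, W2; reflexivity.
Qed.

Lemma comparison_of_cube (C : category) (reg : is_regular C) :
  cube_condition C -> comparison_condition C.
Proof.
intros CC X Y Z U V W f i l k g j h m alpha beta gamma Sf Sl Sg Sh
  Ra Rb Rc Qf Ql P piX piZ Q piU piV lambda HP HQ L1 L2.
pose proof Qf as [Ea1 Ea2]; pose proof Ql as [Ec1 Ec2].
unfold split_by in Sf, Sl, Sg, Sh.
destruct (image_factorization reg lambda) as [A [delta [n [Rd [Mn Hn]]]]].
destruct (@pullback_pair _ _ _ _ _ _ _ _ _ X (idm X) (k o f) HP)
  as [sX [PX1 PX2]].
{ rewrite (precompose Sl), comp_idl; apply comp_idr. }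
destruct (@pullback_pair _ _ _ _ _ _ _ _ _ Z (i o l) (idm Z) HP)
  as [sZ [PZ1 PZ2]].
{ rewrite (precompose Sf), comp_idl; symmetry; apply comp_idr. }
destruct (@pullback_pair _ _ _ _ _ _ _ _ _ U (idm U) (m o g) HQ)
  as [sU [PU1 PU2]].
{ rewrite (precompose Sh), comp_idl; apply comp_idr. }
destruct (@pullback_pair _ _ _ _ _ _ _ _ _ V (j o h) (idm V) HQ)
  as [sV [PV1 PV2]].
{ rewrite (precompose Sg), comp_idl; symmetry; apply comp_idr. }
(* The section [sU = <1, m g>] of [piU] lands in the image [A], since locally,
   along [alpha], it is the image of [sX]; likewise for [sV] below. *)
destruct (@regular_epi_diagonal_monic C X U Q A alpha (delta o sX) n sU)
  as [s [S1 S2]]; [exact Ra | exact Mn | |].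
{ rewrite (precompose Hn); apply (pullback_jointly_monic HQ).
  - rewrite (precompose_square L1), PX1, (precompose PU1), comp_idl.
    apply comp_idr.
  - rewrite (precompose_square L2), PX2, (precompose PU2).
    rewrite (precompose_square Ec2), <- Ea1, comp_assoc; reflexivity. }
destruct (@regular_epi_diagonal_monic C Z V Q A gamma (delta o sZ) n sV)
  as [t [T1 T2]]; [exact Rc | exact Mn | |].
{ rewrite (precompose Hn); apply (pullback_jointly_monic HQ).
  - rewrite (precompose_square L1), PZ1, (precompose PV1).
    rewrite (precompose_square Ea2), <- Ec1, comp_assoc; reflexivity.
  - rewrite (precompose_square L2), PZ2, (precompose PV2), comp_idl.
    apply comp_idr. }
assert (HA : is_pullback g h (piU o n) (piV o n)).
{ apply (CC X Y Z U V W f i l k P piX piZ sX sZ g j h m A (piU o n) s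
    (piV o n) t alpha beta gamma delta); try assumption.
  - unfold split_by; rewrite <- comp_assoc, S2; exact PU1.
  - unfold split_by; rewrite <- comp_assoc, T2; exact PV2.
  - apply (precompose_square (proj1 HQ)).
  - apply Mn; rewrite (precompose S2), (precompose T2).
    apply (pullback_jointly_monic HQ).
    + rewrite (precompose PU1), (precompose PV1), comp_idl, <- comp_assoc, Sh.
      symmetry; apply comp_idr.
    + rewrite (precompose PU2), (precompose PV2), comp_idl, <- comp_assoc, Sg.
      apply comp_idr.
  - split; [rewrite <- comp_assoc, Hn; exact L1 | symmetry; exact S1].
  - split; [rewrite <- comp_assoc, Hn; exact L2 | symmetry; exact T1]. }
destruct (pullback_pair HA (proj1 HQ)) as [n' [N1 N2]].
assert (I : n o n' = idm Q).
{ apply (pullback_jointly_monic HQ); rewrite comp_assoc, comp_idr; assumption. }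
rewrite <- Hn; apply (regular_epi_comp_iso (n' := n') Rd); [|exact I].
apply Mn; rewrite (precompose I), comp_idl, comp_idr; reflexivity.
Qed.

Theorem theorem1p3 (C : category) (C_regular : is_regular C) :
  (goursat C <-> comparison_condition C) /\
  (effective_goursat C <-> comparison_condition C) /\
  (comparison_condition C <-> cube_condition C).
Proof.
split; [split|split; split].
- intros G; apply (comparison_of_effective_goursat C_regular).
  exact (effective_goursat_of_goursat G).
- exact (goursat_of_comparison C_regular).
- exact (comparison_of_effective_goursat C_regular).
- intros CC; apply effective_goursat_of_goursat.
  exact (goursat_of_comparison C_regular CC).
- exact (cube_of_comparison C_regular).
- exact (comparison_of_cube C_regular).
Qed.
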